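(* Let $R$ be an integral domain. (1) The categories $\mathbf{BSp}_R$ and $\mathbf{cBA}$ are equivalent. (2) The categories $\mathbf{BSp}_R$ and $\mathbf{ED}$ are dually equivalent.
   Context: All algebras are commutative and unital and all algebra homomorphisms are unital. For a commutative $R$-algebra $S$, $\mathrm{Id}(S)$ is the set of idempotents of $S$, a Boolean algebra under $e\vee f=e+f-ef$, $e\wedge f=ef$, $\lnot e=1-e$. A nonzero idempotent $e\in S$ is faithful if for each $a\in R$, $ae=0$ implies $a=0$. A faithful generating algebra of idempotents of $S$ is a Boolean subalgebra $B$ of $\mathrm{Id}(S)$ that generates $S$ as an $R$-algebra and all of whose nonzero elements are faithful. $S$ is a Specker $R$-algebra if it is a commutative $R$-algebra that has a faithful generating algebra of idempotents. A commutative ring is a Baer ring if the annihilator ideal of each of its subsets is a principal ideal generated by an idempotent. $\mathbf{Sp}_R$ is the category of Specker $R$-algebras and $R$-algebra homomorphisms, and $\mathbf{BSp}_R$ is its full subcategory of those Specker $R$-algebras that are Baer rings. $\mathbf{cBA}$ is the full subcategory of the category of Boolean algebras and Boolean homomorphisms consisting of the complete Boolean algebras (so morphisms are all Boolean homomorphisms). $\mathbf{ED}$ is the category of extremally disconnected compact Hausdorff spaces and all continuous maps. The one-element Boolean algebra and the empty space are allowed. *)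

(* Defs.v *)
From HB Require Import structures.
From mathcomp Require Import all_boot all_order all_algebra.
From mathcomp Require Import boolp classical_sets topology.

Set Implicit Arguments.
Unset Strict Implicit.
Unset Printing Implicit Defensive.
Import Order.TTheory GRing.Theory.
Local Open Scope classical_set_scope.
Local Open Scope ring_scope.

Record category := Category {
  obj :> Type;
  hom : obj -> obj -> Type;
  idm : forall a, hom a a;
  comp : forall a b c, hom b c -> hom a b -> hom a c;
  compm1 : forall a b (f : hom a b), comp f (idm a) = f;
  comp1m : forall a b (f : hom a b), comp (idm b) f = f;
  compA : forall a b c d (h : hom c d) (g : hom b c) (f : hom a b),
    comp h (comp g f) = comp (comp h g) f
}.
Arguments hom {_} _ _.
Arguments idm {_} _.
Arguments comp {_ _ _ _} _ _.

Record functor (C D : category) := Functor {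
  fobj :> C -> D;
  fhom : forall a b : C, hom a b -> hom (fobj a) (fobj b);
  fhom1 : forall a : C, fhom (idm a) = idm (fobj a);
  fhomM : forall (a b c : C) (g : hom b c) (f : hom a b),
    fhom (comp g f) = comp (fhom g) (fhom f)
}.
Arguments fhom {_ _} _ {_ _} _.

Definition functor_id (C : category) : functor C C :=
  @Functor C C id (fun _ _ f => f) (fun _ => erefl) (fun _ _ _ _ _ => erefl).

Section FunctorComp.
Variables (C D E : category) (G : functor D E) (F : functor C D).

Fact functor_comp1 (a : C) : fhom G (fhom F (idm a)) = idm (G (F a)).
Proof. by rewrite !fhom1. Qed.

Fact functor_compM (a b c : C) (g : hom b c) (f : hom a b) :
  fhom G (fhom F (comp g f)) = comp (fhom G (fhom F g)) (fhom G (fhom F f)).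
Proof. by rewrite !fhomM. Qed.

Definition functor_comp : functor C E :=
  @Functor C E (fun a => G (F a)) (fun _ _ f => fhom G (fhom F f))
    functor_comp1 functor_compM.
End FunctorComp.

Definition is_iso (C : category) (a b : C) (f : hom a b) :=
  exists g : hom b a, comp g f = idm a /\ comp f g = idm b.

Definition naturally_isomorphic (C D : category) (F G : functor C D) :=
  exists eta : forall a : C, hom (F a) (G a),
    (forall (a b : C) (f : hom a b),
       comp (eta b) (fhom F f) = comp (fhom G f) (eta a)) /\
    (forall a, is_iso (eta a)).

Definition equivalent_categories (C D : category) :=
  exists (F : functor C D) (G : functor D C),
    naturally_isomorphic (functor_comp G F) (functor_id C) /\
    naturally_isomorphic (functor_comp F G) (functor_id D).

Definition opposite (C : category) : category :=
  @Category C (fun a b => @hom C b a) (@idm C)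
    (fun _ _ _ g f => comp f g) (fun _ _ f => comp1m f) (fun _ _ f => compm1 f)
    (fun _ _ _ _ h g f => esym (compA f g h)).

Definition dually_equivalent_categories (C D : category) :=
  equivalent_categories (opposite C) D.

Definition full_subcategory (C : category) (P : C -> Prop) : category :=
  @Category {a : C | P a} (fun a b => hom (sval a) (sval b))
    (fun a => idm (sval a)) (fun _ _ _ g f => comp g f)
    (fun _ _ f => compm1 f) (fun _ _ f => comp1m f)
    (fun _ _ _ _ h g f => compA h g f).

(* The category whose objects are indexed by O and have underlying types U,
   and whose morphisms are the functions satisfying P. *)
Section ConcreteCategory.
Variables (O : Type) (U : O -> Type).
Variable P : forall a b : O, (U a -> U b) -> Prop.
Hypothesis P_id : forall a, @P a a idfun.
Hypothesis P_comp : forall a b c (g : U b -> U c) (f : U a -> U b),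
  P g -> P f -> @P a c (g \o f).

Let chom (a b : O) := {f : U a -> U b | P f}.
Let cidm a : chom a a := exist _ idfun (P_id a).
Let ccomp a b c (g : chom b c) (f : chom a b) : chom a c :=
  exist _ (sval g \o sval f) (P_comp (svalP g) (svalP f)).

Fact concrete_compm1 a b (f : chom a b) : ccomp f (cidm a) = f.
Proof. by case: f => f Pf; exact: eq_exist. Qed.

Fact concrete_comp1m a b (f : chom a b) : ccomp (cidm b) f = f.
Proof. by case: f => f Pf; exact: eq_exist. Qed.

Fact concrete_compA a b c d (h : chom c d) (g : chom b c) (f : chom a b) :
  ccomp h (ccomp g f) = ccomp (ccomp h g) f.
Proof. exact: eq_exist. Qed.

Definition concrete_category : category :=
  Category concrete_compm1 concrete_comp1m concrete_compA.
End ConcreteCategory.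

(* The algebra structures of the library require 1 != 0, which would exclude
   the zero algebra, the Specker algebra of the one-element Boolean algebra.
   Here a commutative R-algebra is a commutative ring S together with a ring
   morphism R -> S, and a acts on s as alg_map S a * s. *)
Record comAlg (R : comPzRingType) := ComAlg {
  comAlg_ring :> comPzRingType;
  alg_map : {rmorphism R -> comAlg_ring}
}.
Arguments alg_map {R} _.

Section Algebras.
Variable R : comPzRingType.

Definition is_alg_hom (A B : comAlg R) (f : A -> B) : Prop :=
  [/\ {morph f : x y / x + y}, {morph f : x y / x * y}, f 1 = 1 &
      forall (a : R) (s : A), f (alg_map A a * s) = alg_map B a * f s].

Fact alg_hom_id (A : comAlg R) : is_alg_hom (@idfun A).
Proof. by []. Qed.

Fact alg_hom_comp (A B C : comAlg R) (g : B -> C) (f : A -> B) :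
  is_alg_hom g -> is_alg_hom f -> is_alg_hom (g \o f).
Proof.
move=> [gD gM g1 gZ] [fD fM f1 fZ]; split=> [x y|x y||a s] /=.
- by rewrite fD gD.
- by rewrite fM gM.
- by rewrite f1 g1.
- by rewrite fZ gZ.
Qed.

Definition CAlg : category := concrete_category alg_hom_id alg_hom_comp.

Section OneAlgebra.
Variable S : comAlg R.

Definition idempotents : set S := [set e | e * e = e].

Definition boolean_subalgebra (B : set S) :=
  [/\ B `<=` idempotents, B 0, B 1 &
   [/\ forall e f, B e -> B f -> B (e + f - e * f),
       forall e f, B e -> B f -> B (e * f) &
       forall e, B e -> B (1 - e)]].

Definition is_subalgebra (A : set S) :=
  [/\ A 1, forall u v, A u -> A v -> A (u + v),
      forall u v, A u -> A v -> A (u * v) &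
      forall (a : R) u, A u -> A (alg_map S a * u)].

Definition generates (B : set S) := smallest is_subalgebra B = setT.

Definition faithful (e : S) := forall a : R, alg_map S a * e = 0 -> a = 0.

Definition faithful_generating_algebra (B : set S) :=
  [/\ boolean_subalgebra B, generates B &
      forall e, B e -> e != 0 -> faithful e].

Definition is_specker := exists B : set S, faithful_generating_algebra B.
End OneAlgebra.

Definition Sp : category := full_subcategory (fun S : CAlg => is_specker S).
End Algebras.

Section Baer.
Variable S : comPzRingType.

Definition annihilator (X : set S) : set S :=
  [set a | forall x, X x -> a * x = 0].

Definition is_baer := forall X : set S,
  exists e : S, e * e = e /\ annihilator X = range (fun s => s * e).
End Baer.

Definition BSp (R : comPzRingType) : category :=
  full_subcategory (fun S : Sp R => is_baer (sval S)).

(* The display of a library lattice only controls notations. *)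
Record boolAlg := BoolAlg {
  boolAlg_disp : Order.disp_t;
  boolAlg_sort :> ctbDistrLatticeType boolAlg_disp
}.

Section BooleanAlgebras.
Local Open Scope order_scope.

(* The library's {tblmorphism _ -> _} only asks for \bot and \top to be
   preserved. *)
Definition is_bool_hom (A B : boolAlg) (f : A -> B) : Prop :=
  [/\ {morph f : x y / Order.meet x y}, {morph f : x y / Order.join x y},
      {morph f : x / Order.compl x}, f \bot = \bot & f \top = \top].

Fact bool_hom_id (A : boolAlg) : is_bool_hom (@idfun A).
Proof. by []. Qed.

Fact bool_hom_comp (A B C : boolAlg) (g : B -> C) (f : A -> B) :
  is_bool_hom g -> is_bool_hom f -> is_bool_hom (g \o f).
Proof.
move=> [gI gU gC g0 g1] [fI fU fC f0 f1]; split=> [x y|x y|x||] /=.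
- by rewrite fI gI.
- by rewrite fU gU.
- by rewrite fC gC.
- by rewrite f0 g0.
- by rewrite f1 g1.
Qed.

Definition BA : category := concrete_category bool_hom_id bool_hom_comp.

Definition is_complete (A : boolAlg) := forall X : set A,
  supremums X !=set0 /\ infimums X !=set0.

Definition cBA : category := full_subcategory (fun A : BA => is_complete A).
End BooleanAlgebras.

Fact continuous_idfun (X : topologicalType) : continuous (@idfun X).
Proof. by move=> x; exact: cvg_id. Qed.

Fact continuous_compose (X Y Z : topologicalType) (g : Y -> Z) (f : X -> Y) :
  continuous g -> continuous f -> continuous (g \o f).
Proof. by move=> gc fc x; apply: continuous_comp; [exact: fc|exact: gc]. Qed.

Definition Top : category :=
  concrete_category continuous_idfun continuous_compose.

Definition extremally_disconnected (X : topologicalType) :=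
  forall U : set X, open U -> open (closure U).

Definition ED : category := full_subcategory (fun X : Top =>
  [/\ compact [set: X], hausdorff_space X & extremally_disconnected X]).

(* Main.v *)
(* The idempotent functor S |-> Id(S) is an equivalence from Baer Specker algebras to complete Boolean algebras, and its composite with the Stone space functor is the duality.

   Full faithfulness: over a domain the idempotents of a Specker algebra are exactly its faithful generating algebra B, and every element takes a scalar value on each piece of a finite partition of unity in B. A Boolean homomorphism phi on B extends by carrying these values along phi; faithfulness makes the extension well defined, since 0 has the value 0 on every nonzero piece. Stone spaces of complete Boolean algebras are extremally disconnected, and a continuous map between Stone spaces pulls clopens back to clopens, hence comes from a unique homomorphism.

   Essential surjectivity: for X compact and extremally disconnected, the locally constant functions X -> R form a Baer Specker algebra whose idempotents are the indicators of the clopens of X. With X the Stone space of A this recovers A, and with X Hausdorff it recovers X as the Stone space of the idempotents. *)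
From HB Require Import structures.
From mathcomp Require Import all_boot all_order all_algebra.
From mathcomp Require Import ring boolp classical_sets functions.
From mathcomp Require Import topology filter.
Require Import Defs.

Set Implicit Arguments.
Unset Strict Implicit.
Unset Printing Implicit Defensive.
Import Order.Theory GRing.Theory.
Local Open Scope classical_set_scope.
Local Open Scope ring_scope.

(** * Equivalences from fully faithful and essentially surjective functors *)

Definition opposite_functor (C D : category) (F : functor C D) :
    functor (opposite C) (opposite D) :=
  @Functor (opposite C) (opposite D) F (fun a b f => @fhom C D F b a f)
    (fhom1 F) (fun _ _ _ g f => @fhomM C D F _ _ _ f g).

Definition fully_faithful (C D : category) (F : functor C D) :=
  forall a b : C, (forall f g : hom a b, fhom F f = fhom F g -> f = g) /\
    (forall g : hom (F a) (F b), exists f : hom a b, fhom F f = g).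

Definition essentially_surjective (C D : category) (F : functor C D) :=
  forall d : D, exists (c : C) (u : hom (F c) d), is_iso u.

Lemma fully_faithful_opposite (C D : category) (F : functor C D) :
  fully_faithful F -> fully_faithful (opposite_functor F).
Proof. by move=> FF a b; exact: FF. Qed.

Lemma fully_faithful_comp (C D E : category) (G : functor D E)
    (F : functor C D) :
  fully_faithful G -> fully_faithful F -> fully_faithful (functor_comp G F).
Proof.
move=> Gff Fff a b; split=> [f g /= /(Gff _ _).1/(Fff _ _).1 //|h].
have [g <-] := (Gff _ _).2 h; have [f <-] := (Fff _ _).2 g; by exists f.
Qed.

Section QuasiInverse.
Variables (C D : category) (F : functor C D).
Hypotheses (Fff : fully_faithful F) (Fes : essentially_surjective F).

Let inj a b (f g : hom a b) : fhom F f = fhom F g -> f = g := (Fff a b).1 f g.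
Let lift a b (g : hom (F a) (F b)) : hom a b := sval (cid ((Fff a b).2 g)).
Let liftK a b (g : hom (F a) (F b)) : fhom F (lift g) = g :=
  svalP (cid ((Fff a b).2 g)).

Let G d : C := sval (cid (Fes d)).
Let eps d : hom (F (G d)) d := sval (cid (svalP (cid (Fes d)))).
Let epsV d : hom d (F (G d)) := sval (cid (svalP (cid (svalP (cid (Fes d)))))).
Let epsVK d : comp (epsV d) (eps d) = idm _.
Proof. by have [] := svalP (cid (svalP (cid (svalP (cid (Fes d)))))). Qed.
Let epsK d : comp (eps d) (epsV d) = idm _.
Proof. by have [] := svalP (cid (svalP (cid (svalP (cid (Fes d)))))). Qed.

(** Fullness lifts the conjugate of [h] by the chosen isomorphisms. Faithfulness then reduces each
    law of the quasi-inverse to cancelling [eps] against [epsV] in [D]. *)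
Let Ghom d d' (h : hom d d') : hom (G d) (G d') :=
  lift (comp (epsV d') (comp h (eps d))).

Fact quasi_inverse1 d : Ghom (idm d) = idm (G d).
Proof. by apply: inj; rewrite liftK comp1m epsVK fhom1. Qed.

Fact quasi_inverseM a b c (g : hom b c) (f : hom a b) :
  Ghom (comp g f) = comp (Ghom g) (Ghom f).
Proof.
apply: inj; rewrite fhomM !liftK -!compA; do 2![congr comp].
by rewrite (compA (eps b)) epsK comp1m.
Qed.

Definition quasi_inverse : functor D C := Functor quasi_inverse1 quasi_inverseM.

Lemma equivalence_of_fully_faithful : equivalent_categories C D.
Proof.
exists F, quasi_inverse; split.
(* The component at [a] lifts [eps (F a)]; the lift of [epsV (F a)] inverts it, again by
   faithfulness. *)
- exists (fun a => lift (eps (F a))); split=> [a b f|a].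
    apply: inj; rewrite !fhomM /= !liftK compA epsK comp1m //.
  exists (lift (epsV (F a))).
  by split; apply: inj; rewrite fhomM !liftK ?epsK ?epsVK fhom1.
- exists eps; split=> [a b f|a]; last first.
    by exists (epsV a); split; [exact: epsVK|exact: epsK].
  by rewrite /= liftK compA epsK comp1m.
Qed.
End QuasiInverse.

(** * The Boolean algebra of idempotents *)

(** The boolean equation makes this a subtype with irrelevant proofs, so equality of idempotents
    becomes a ring identity between values. *)
Definition idem (S : comPzRingType) := {e : S | e * e == e}.
HB.instance Definition _ (S : comPzRingType) := Choice.on (idem S).

Section IdempotentAlgebra.
Variable S : comPzRingType.
Implicit Types e f g : idem S.

Lemma idemE e : val e * val e = val e. Proof. exact/eqP/(valP e). Qed.

Definition idem_of (e : S) (ee : e * e = e) : idem S :=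
  exist _ e (introT eqP ee).

Fact idemM_subproof e f : val e * val f * (val e * val f) = val e * val f.
Proof. by ring: (idemE e) (idemE f). Qed.
Fact idemU_subproof e f :
  (val e + val f - val e * val f) * (val e + val f - val e * val f) =
  val e + val f - val e * val f.
Proof. by ring: (idemE e) (idemE f). Qed.
Fact idemC_subproof e : (1 - val e) * (1 - val e) = 1 - val e.
Proof. by ring: (idemE e). Qed.

Definition idem_meet e f := idem_of (idemM_subproof e f).
Definition idem_join e f := idem_of (idemU_subproof e f).
Definition idem_compl e := idem_of (idemC_subproof e).
Definition idem0 : idem S := idem_of (mul0r (0 : S)).
Definition idem1 : idem S := idem_of (mul1r (1 : S)).

Fact idem_meetC : commutative idem_meet.
Proof. by move=> e f; apply: val_inj => /=; ring. Qed.
Fact idem_joinC : commutative idem_join.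
Proof. by move=> e f; apply: val_inj => /=; ring. Qed.
Fact idem_meetA : associative idem_meet.
Proof. by move=> e f g; apply: val_inj => /=; ring. Qed.
Fact idem_joinA : associative idem_join.
Proof. by move=> e f g; apply: val_inj => /=; ring. Qed.
Fact idem_joinKI f e : idem_meet e (idem_join e f) = e.
Proof. by apply: val_inj; have /= ee := idemE e; ring: ee. Qed.
Fact idem_meetKU f e : idem_join e (idem_meet e f) = e.
Proof. by apply: val_inj; have /= ee := idemE e; ring: ee. Qed.
Fact idem_meetUl : left_distributive idem_meet idem_join.
Proof. by move=> e f g; apply: val_inj; have /= ee := idemE g; ring: ee. Qed.
Fact idem_meetxx : idempotent_op idem_meet.
Proof. by move=> e; apply: val_inj; exact: idemE. Qed.

Fact idem_display : Order.disp_t. Proof. exact: Order.Disp tt tt. Qed.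

HB.instance Definition _ := Order.isMeetJoinDistrLattice.Build
  idem_display (idem S) (fun _ _ => erefl) (fun _ _ => erefl)
  idem_meetC idem_joinC idem_meetA idem_joinA
  idem_joinKI idem_meetKU idem_meetUl idem_meetxx.

Fact idem_le0x e : (idem0 <= e)%O.
Proof. by apply/eqP/val_inj => /=; rewrite mul0r. Qed.
HB.instance Definition _ :=
  Order.hasBottom.Build idem_display (idem S) idem_le0x.

Fact idem_lex1 e : (e <= idem1)%O.
Proof. by apply/eqP/val_inj => /=; rewrite mulr1. Qed.
HB.instance Definition _ :=
  Order.hasTop.Build idem_display (idem S) idem_lex1.

Fact idem_joinxC e : (e `|` idem_compl e)%O = \top%O.
Proof. by apply: val_inj; have /= ee := idemE e; ring: ee. Qed.
Fact idem_meetxC e : (e `&` idem_compl e)%O = \bot%O.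
Proof. by apply: val_inj; have /= ee := idemE e; ring: ee. Qed.
HB.instance Definition _ :=
  Order.TBDistrLattice_hasComplement.Build idem_display (idem S)
    idem_joinxC idem_meetxC.

Lemma val_meet e f : val (e `&` f)%O = val e * val f. Proof. by []. Qed.
Lemma val_compl e : val (~` e)%O = 1 - val e. Proof. by []. Qed.
End IdempotentAlgebra.

Definition idemBA (S : comPzRingType) : boolAlg :=
  BoolAlg (idem S : ctbDistrLatticeType _).

(** The infimum of [X] is the supremum of its lower bounds. *)
Lemma complete_of_sup (A : boolAlg) :
  (forall X : set A, supremums X !=set0) -> is_complete A.
Proof.
move=> supA X; split=> //; have [s [ubs lubs]] := supA (lbound X).
exists s; split=> [x Xx|y ylb]; last exact: ubs.
by apply: lubs => y; apply.
Qed.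

(** If the idempotent [e] generates the annihilator of [X], then [1 - e] is the supremum of [X]: [e]
    kills [X], and [y] is an upper bound only if [1 - y] annihilates [X], hence is a multiple of
    [e]. *)
Lemma idem_complete (S : comPzRingType) : is_baer S -> is_complete (idemBA S).
Proof.
move=> baerS; apply: complete_of_sup => X.
have [e [ee annX]] := baerS [set val x | x in X].
have eX x : X x -> e * val x = 0.
  have : annihilator [set val x | x in X] e by rewrite annX; exists e.
  by move=> + Xx; apply; exists x.
exists (~` (idem_of ee))%O; split=> [x Xx|y yub].
  by apply/eqP/val_inj; rewrite /= mulrBr mulr1 mulrC eX ?subr0.
have : annihilator [set val x | x in X] (1 - val y).
  move=> _ [x Xx <-]; have /eqP/(congr1 val) /= := yub x Xx.
  by move=> xy; rewrite mulrBl mul1r mulrC xy subrr.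
rewrite annX => -[s _ se].
apply/eqP/val_inj; rewrite /= -/(val y).
have -> : val y = 1 - s * e by rewrite se; ring.
by ring: ee.
Qed.

Section Map.
Variables (S T : comPzRingType) (f : S -> T).
Hypotheses (fD : {morph f : x y / x + y}) (fM : {morph f : x y / x * y}).
Hypothesis f1 : f 1 = 1.

Fact idem_map_subproof (e : idem S) : f (val e) * f (val e) = f (val e).
Proof. by rewrite -fM idemE. Qed.
Definition idem_map (e : idem S) : idem T := idem_of (idem_map_subproof e).

Lemma idem_map_bool_hom : @is_bool_hom (idemBA S) (idemBA T) idem_map.
Proof.
have f0 : f 0 = 0 by apply: (addIr (f 0)); rewrite -fD !add0r.
have fN x : f (- x) = - f x by apply: (addIr (f x)); rewrite -fD !addNr.
by split=> [x y|x y|x||]; apply: val_inj; rewrite /= ?fD ?fN ?fD ?fM ?f1 ?f0.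
Qed.
End Map.

Lemma sval_inj (T : Type) (P : T -> Prop) : injective (@sval T P).
Proof. by move=> [x Px] [y Py] /= xy; exact: eq_exist. Qed.

(** * The functor of idempotents *)

Section Functor.
Variable R : comPzRingType.

Definition idem_fobj (S : BSp R) : cBA :=
  exist _ (idemBA (sval (sval S))) (idem_complete (svalP S)).

Definition idem_fhom (S T : BSp R) (f : hom S T) :
    hom (idem_fobj S) (idem_fobj T) :=
  let: And4 fD fM f1 _ := svalP f in
  exist _ (idem_map fM) (idem_map_bool_hom fD fM f1).

(** [idem_fhom] matches on the proof [svalP f], which is stuck for a variable [f]; this equation
    replaces the blocked computation. *)
Lemma val_idem_fhom (S T : BSp R) (f : hom S T) (e : idem (sval (sval S))) :
  val (sval (idem_fhom f) e) = sval f (val e).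
Proof. by rewrite /idem_fhom; case: (svalP f). Qed.

Fact idem_fhom1 (S : BSp R) : idem_fhom (idm S) = idm (idem_fobj S).
Proof.
by apply: sval_inj; apply/funext => e; apply: val_inj; exact: val_idem_fhom.
Qed.

Fact idem_fhomM (S T U : BSp R) (g : hom T U) (f : hom S T) :
  idem_fhom (comp g f) = comp (idem_fhom g) (idem_fhom f).
Proof.
by apply: sval_inj; apply/funext => e; apply: val_inj; rewrite /= !val_idem_fhom.
Qed.

Definition idem_functor : functor (BSp R) cBA := Functor idem_fhom1 idem_fhomM.
End Functor.

(** * Homomorphisms out of a Specker algebra *)

Lemma generates_ind (R : comPzRingType) (S : comAlg R) (B A : set S) :
  generates B -> is_subalgebra A -> B `<=` A -> forall s, A s.
Proof.
move=> genB subA BA s; have : smallest (@is_subalgebra R S) B s by rewrite genB.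
by move=> /(_ A); apply.
Qed.

Section Piecewise.
Variables (R : idomainType) (S T : comAlg R) (B : set S) (phi : S -> T).
Hypothesis FB : faithful_generating_algebra B.
Hypothesis phi1 : phi 1 = 1.
Hypothesis phiM : forall e f, B e -> B f -> phi (e * f) = phi e * phi f.
Hypothesis phiC : forall e, B e -> phi (1 - e) = 1 - phi e.

Let B1 : B 1. Proof. by have [[]] := FB. Qed.
Let BM e f : B e -> B f -> B (e * f).
Proof. by have [[_ _ _ []]] := FB => ? + *; apply. Qed.
Let BC e : B e -> B (1 - e).
Proof. by have [[_ _ _ []]] := FB => ? ? + *; apply. Qed.
Let BU e f : B e -> B f -> B (e + f - e * f).
Proof. by have [[_ _ _ []]] := FB => + *; apply. Qed.
Let Bidem e : B e -> e * e = e.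
Proof. by have [[+ _ _ _]] := FB => + *; apply. Qed.
Let phi0 : phi 0 = 0.
Proof. by have := phiC B1; rewrite phi1 !subrr. Qed.

(* On each piece of some finite partition of e by elements of B, s and t take
   the same scalar value. *)
Inductive piecewise : S -> S -> T -> Prop :=
| PiecewiseConst e s t r :
    s * e = alg_map S r * e -> t * phi e = alg_map T r * phi e -> piecewise e s t
| PiecewiseSplit e x s t : B x ->
    piecewise (e * x) s t -> piecewise (e * (1 - x)) s t -> piecewise e s t.

(** Cuts a partition along an element of [B]; this is what gives two partitions a common
    refinement. *)
Lemma piecewise_restrict e x s t :
  B e -> B x -> piecewise e s t -> piecewise (e * x) s t.
Proof.
move=> Be Bx pe; elim: pe Be => {e s t} [e s t r se te|e y s t By _ IH1 _ IH2] Be.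
  by apply: (@PiecewiseConst _ _ _ r); rewrite ?phiM // mulrA ?se ?te mulrA.
apply: (PiecewiseSplit By); rewrite mulrAC; [apply: IH1|apply: IH2];
  exact: BM (BC _) || exact: BM.
Qed.

(** Handles sums and products at once. The outer induction follows the partition for [s],
    restricting the one for [s'] to each piece; once [s] is scalar on a piece, an inner induction
    follows the partition for [s']. *)
Lemma piecewise_op (opS : S -> S -> S) (opT : T -> T -> T) (opR : R -> R -> R) :
  (forall e s s' r r', s * e = alg_map S r * e -> s' * e = alg_map S r' * e ->
     opS s s' * e = alg_map S (opR r r') * e) ->
  (forall e s s' r r', s * e = alg_map T r * e -> s' * e = alg_map T r' * e ->
     opT s s' * e = alg_map T (opR r r') * e) ->
  forall e s t s' t', B e -> piecewise e s t -> piecewise e s' t' ->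
    piecewise e (opS s s') (opT t t').
Proof.
move=> opSE opTE e s t s' t' Be pe.
elim: pe Be => {e s t} [e s t r se te|e y s t By _ IH1 _ IH2] Be pe'.
- elim: pe' Be se te => {e s' t'} [e s' t' r' se' te'|e y s' t' By _ IH1 _ IH2] Be se te.
    by apply: (@PiecewiseConst _ _ _ (opR r r')); [exact: opSE|exact: opTE].
  apply: (PiecewiseSplit By); [apply: IH1|apply: IH2]; rewrite ?phiM ?mulrA ?se ?te //;
    by [exact: BM | exact: BC | exact: BM (BC _)].
- apply: (PiecewiseSplit By); [apply: IH1|apply: IH2];
    by [exact: BM | exact: BM (BC _) | exact: piecewise_restrict |
        apply: piecewise_restrict => //; exact: BC].
Qed.

Lemma piecewise_add e s t s' t' : B e -> piecewise e s t -> piecewise e s' t' ->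
  piecewise e (s + s') (t + t').
Proof.
apply: (piecewise_op (opR := +%R)) => {}e x y r r' xe ye;
  by rewrite rmorphD !mulrDl xe ye.
Qed.

Lemma piecewise_mul e s t s' t' : B e -> piecewise e s t -> piecewise e s' t' ->
  piecewise e (s * s') (t * t').
Proof.
apply: (piecewise_op (opR := *%R)) => {}e x y r r' xe ye;
  by rewrite rmorphM -!mulrA ye mulrCA xe mulrCA.
Qed.

Lemma piecewise_const r : piecewise 1 (alg_map S r) (alg_map T r).
Proof. exact: (@PiecewiseConst _ _ _ r). Qed.

(** The partition is [e], [1 - e], with scalar values 1 and 0. *)
Lemma piecewise_gen e : B e -> piecewise 1 e (phi e).
Proof.
move=> Be; apply: (PiecewiseSplit Be).
  apply: (@PiecewiseConst _ _ _ 1);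
    by rewrite ?rmorph1 ?phiM ?phi1 ?mul1r -?phiM ?Bidem.
apply: (@PiecewiseConst _ _ _ 0);
  rewrite ?rmorph0 ?mul0r ?mul1r ?phiC // mulrBr mulr1 -?phiM ?Bidem ?subrr //.
Qed.

(** On a nonzero piece faithfulness forces the scalar value of 0 to be 0; on the piece 0 the factor
    [phi 0] vanishes. *)
Lemma piecewise0 e s t : B e -> piecewise e s t -> s = 0 -> t * phi e = 0.
Proof.
move=> Be pe; elim: pe Be => {e s t} [e s t r se te|e y s t By _ IH1 _ IH2] Be s0.
  have [_ _ faithB] := FB; rewrite te.
  have [->|e0] := eqVneq e 0; first by rewrite phi0 mulr0.
  by rewrite (faithB e Be e0 r) ?rmorph0 ?mul0r // -se s0 mul0r.
have := IH1 (BM Be By) s0; have := IH2 (BM Be (BC By)) s0.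
rewrite !phiM ?phiC //; last exact: BC.
(* [t * phi e] is the sum of its products with [phi y] and [1 - phi y], both zero. *)
by move=> h2 h1; rewrite -[RHS](addr0 0) -{1}h1 -h2; ring.
Qed.

(** [t - t'] is a value of [s - s = 0] on the piece 1, so it vanishes. *)
Lemma piecewise_unique s t t' : piecewise 1 s t -> piecewise 1 s t' -> t = t'.
Proof.
move=> st st'; apply: subr0_eq.
have := piecewise_add B1 st (piecewise_mul B1 (piecewise_const (-1)) st').
rewrite !rmorphN !rmorph1 !mulN1r subrr => /(piecewise0 B1)/(_ erefl).
by rewrite phi1 mulr1.
Qed.

(** The elements that have a value form a subalgebra containing the generators [B]. *)
Lemma piecewise_total s : exists t, piecewise 1 s t.
Proof.
have [_ genB _] := FB.
pose A := [set s : S | exists t, piecewise 1 s t].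
apply: (@generates_ind _ _ _ A genB) => [|e Be]; last first.
  by exists (phi e); exact: piecewise_gen.
split=> [|u v [t ut] [t' vt']|u v [t ut] [t' vt']|a u [t ut]].
- by exists 1; have := piecewise_const 1; rewrite !rmorph1.
- by exists (t + t'); exact: piecewise_add.
- by exists (t * t'); exact: piecewise_mul.
- by exists (alg_map T a * t); apply: piecewise_mul => //; exact: piecewise_const.
Qed.

(** The relation [piecewise 1] is the graph of the extension: it is total, single-valued and
    compatible with the operations. *)
Lemma specker_extension :
  exists2 f : S -> T, is_alg_hom f & forall e, B e -> f e = phi e.
Proof.
have [f fP] := choice piecewise_total.
exists f => [|e Be]; last exact: piecewise_unique (fP e) (piecewise_gen Be).
split=> [x y|x y||a s]; apply: piecewise_unique (fP _) _.
- exact: piecewise_add.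
- exact: piecewise_mul.
- by have := piecewise_const 1; rewrite !rmorph1.
- by apply: piecewise_mul => //; exact: piecewise_const.
Qed.

(** On a nonzero piece faithfulness makes the scalar value [r] of an idempotent satisfy [r * r = r];
    in a domain [r] is 0 or 1, so [s * e] is 0 or [e]. *)
Lemma piecewise_idem e s t : B e -> piecewise e s t -> s * s = s -> B (s * e).
Proof.
move=> Be pe; elim: pe Be => {e s t} [e s t r se te|e y s t By _ IH1 _ IH2] Be ss.
  have [[_ B0 _ _] _ faithB] := FB.
  have [->|e0] := eqVneq e 0; first by rewrite mulr0.
  have : r * r - r = 0.
    apply: (faithB e) => //; rewrite rmorphB rmorphM mulrBl -mulrA -se.
    by rewrite mulrCA -se mulrA ss subrr.
  rewrite se -{3}[r]mulr1 -mulrBr => /eqP; rewrite mulf_eq0 subr_eq0.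
  by case/orP => /eqP ->; rewrite ?rmorph0 ?rmorph1 ?mul0r ?mul1r.
(* The parts of [s * e] below [y] and [1 - y] are disjoint, so their join is their sum [s * e]. *)
have := BU (IH1 (BM Be By) ss) (IH2 (BM Be (BC By)) ss).
congr B.
have yy := Bidem By; by ring: ss yy.
Qed.

End Piecewise.

(** * Full faithfulness of the idempotent functor *)

Section Domain.
Variables (R : idomainType).

(** With [T = S] and [phi] the identity, every element is piecewise scalar over [B], so
    [piecewise_idem] applies on the piece 1. *)
Lemma specker_idempotents (S : comAlg R) (B : set S) :
  faithful_generating_algebra B -> forall e, e * e = e -> B e.
Proof.
move=> FB e ee.
have [t et] := @piecewise_total _ _ S B id FB erefl (fun _ _ _ _ => erefl)
  (fun _ _ => erefl) e.
by rewrite -[e]mulr1; apply: piecewise_idem et ee => //; have [[]] := FB.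
Qed.

Lemma idem_functor_full_faithful : fully_faithful (idem_functor R).
Proof.
move=> S T.
have [B FB] := svalP (sval S).
have [[Bidem _ _ _] genB _] := FB.
split=> [f g fg|g].
  have fgE e : e * e = e -> sval f e = sval g e.
    move=> ee.
    have : sval (fhom (idem_functor R) f) (idem_of ee) =
           sval (fhom (idem_functor R) g) (idem_of ee) by rewrite fg.
    by move=> /(congr1 val); rewrite !val_idem_fhom.
  (* Faithfulness: the equalizer of [f] and [g] is a subalgebra containing the generating set
     [B]. *)
  apply: sval_inj; apply/funext.
  apply: (generates_ind (B := B) (A := [set s | sval f s = sval g s])) => //.
    have [fD fM f1 fZ] := svalP f; have [gD gM g1 gZ] := svalP g.
    split=> [|u v /= fgu fgv|u v /= fgu fgv|a u /= fgu].
    + by rewrite /= f1 g1.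
    + by rewrite fD gD fgu fgv.
    + by rewrite fM gM fgu fgv.
    + by rewrite fZ gZ fgu.
  by move=> e /Bidem; exact: fgE.
case: g => g [gI gU gC g0 g1].
(* The extension lemma takes a function on all of [S]; 0 is a filler value off the idempotents. *)
pose phi (s : sval (sval S)) : sval (sval T) :=
  if pselect (s * s = s) is left ss then val (g (idem_of ss)) else 0.
have phiE (e : idem (sval (sval S))) : phi (val e) = val (g e).
  rewrite /phi; case: pselect => [ee|]; last by have := idemE e.
  by congr (val (g _)); exact: val_inj.
have liftB e : B e -> exists2 x : idem (sval (sval S)), e = val x & True.
  by move=> /Bidem ee; exists (idem_of ee).
have phi1 : phi 1 = 1.
  by rewrite (phiE \top%O) g1.
have phiM e f : B e -> B f -> phi (e * f) = phi e * phi f.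
  move=> /liftB[x -> _] /liftB[y -> _].
  by rewrite -val_meet !phiE gI.
have phiC e : B e -> phi (1 - e) = 1 - phi e.
  by move=> /liftB[x -> _]; rewrite -val_compl !phiE gC.
have [f fhom fphi] := specker_extension FB phi1 phiM phiC.
exists (exist _ f fhom); apply: sval_inj; apply/funext => e; apply: val_inj.
(* The extension agrees with [phi] on [B], and [B] contains every idempotent. *)
rewrite val_idem_fhom /= -phiE; apply: fphi.
by apply: specker_idempotents => //; exact: idemE.
Qed.
End Domain.

(** * Stone spaces *)

(** If [P setT] failed, the sets whose complement satisfies [P] would form a proper filter. At a
    cluster point [x], a neighbourhood [U] with [P U] would have to meet its own complement. *)
Lemma compact_induction (X : topologicalType) (P : set X -> Prop) :
  compact [set: X] -> P set0 ->
  (forall U V, P U -> P V -> P (U `|` V)) ->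
  (forall U V, U `<=` V -> P V -> P U) ->
  (forall x : X, exists2 U : set X, nbhs x U & P U) -> P setT.
Proof.
move=> cX P0 PU PS Ploc; apply: contrapT => nPT.
pose F := [set A : set X | P (~` A)].
have FF : ProperFilter F.
  split; first by rewrite /F /= setC0.
  split; first by rewrite /F /= setCT.
    by move=> A B; rewrite /F /= setCI => *; exact: PU.
  by move=> A B AB; apply: PS; exact: subsetC.
have [|x [_ Fx]] := cX F FF; first by rewrite /F /= setCT.
have [U xU PU'] := Ploc x.
have [|y [nUy Uy]] := Fx (~` U) U _ xU; last exact: nUy.
by rewrite /F /= setCK.
Qed.

Section StoneSpace.
Variable A : boolAlg.
Implicit Types x y z a b : A.
Local Open Scope order_scope.

(** Stated as a Boolean homomorphism into truth values; upward closure and the exclusion of the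
    bottom element follow. *)
Definition ultrafilter_of (p : set A) :=
  [/\ p \top, forall x y, p (x `&` y) <-> p x /\ p y &
      forall x, p (~` x) <-> ~ p x].

Definition stone := {p : set A | ultrafilter_of p}.
HB.instance Definition _ := gen_eqMixin stone.
HB.instance Definition _ := gen_choiceMixin stone.

Definition basic a : set stone := [set p | sval p a].

Lemma basicT : basic \top = setT.
Proof. by apply/seteqP; split=> // p _; have [] := svalP p. Qed.

Lemma basicI a b : basic (a `&` b) = (basic a `&` basic b)%classic.
Proof. by apply/seteqP; split=> p; have [_ + _] := svalP p => /(_ a b) []. Qed.

Lemma basicC a : basic (~` a) = (~` basic a)%classic.
Proof. by apply/seteqP; split=> p; have [_ _ +] := svalP p => /(_ a) []. Qed.

Lemma basicU a b : basic (a `|` b) = (basic a `|` basic b)%classic.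
Proof. by rewrite -[a `|` b]complK complU basicC basicI !basicC setCI !setCK. Qed.

Lemma basic0 : basic \bot = set0.
Proof. by rewrite -compl1 basicC basicT setCT. Qed.

Definition stone_open (O : set stone) :=
  forall p, O p -> exists2 a, basic a p & (basic a `<=` O)%classic.

Fact stone_openT : stone_open setT.
Proof. by move=> p _; exists \top => //; rewrite basicT. Qed.

Fact stone_openI : setI_closed stone_open.
Proof.
move=> O O' oO oO' p [/oO[a pa aO] /oO'[b pb bO']].
by exists (a `&` b); rewrite basicI//; exact: setISS.
Qed.

Fact stone_open_bigU (I : Type) (f : I -> set stone) :
  (forall i, stone_open (f i)) -> stone_open (\bigcup_i f i).
Proof.
move=> fo p [i _ /fo[a pa af]]; exists a => //.
by move=> q /af fq; exists i.
Qed.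

HB.instance Definition _ :=
  isOpenTopological.Build stone stone_openT stone_openI stone_open_bigU.

Lemma stone_openE (O : set stone) : open O = stone_open O.
Proof. by []. Qed.

Lemma basic_open a : open (basic a).
Proof. by rewrite stone_openE => p; exists a. Qed.

Lemma basic_closed a : closed (basic a).
Proof. by rewrite -[basic a]setCK -basicC; exact/open_closedC/basic_open. Qed.

(** An ultrafilter [F] on the space converges to the point consisting of the [a] with [basic a] in
    [F]. *)
Lemma stone_compact : compact [set: stone].
Proof.
rewrite compact_ultra => F UF _.
have up : ultrafilter_of [set a | F (basic a)].
  split=> [|x y|x] /=.
  - by rewrite basicT; exact: filterT.
  - rewrite basicI; split=> [Fxy|[Fx Fy]]; last exact: filterI.
    by split; apply: filterS Fxy; [exact: subIsetl|exact: subIsetr].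
  - rewrite basicC; split=> [FC Fx|]; last first.
      by have [] := in_ultra_setVsetC (basic x) UF.
    by apply: (@filter_not_empty _ F); rewrite -(setICr (basic x)); exact: filterI.
exists (exist _ _ up); split=> // U /=; rewrite nbhsE => -[O [oO Op] OU].
by have [a Fa aO] := oO _ Op; apply: filterS Fa; exact: subset_trans OU.
Qed.

(** One inclusion suffices, because ultrafilters are maximal: the other follows by taking
    complements. *)
Lemma stone_ext (p q : stone) : (forall a, basic a p -> basic a q) -> p = q.
Proof.
move=> pq; apply: sval_inj; apply/seteqP; split=> [a|a qa]; first exact: pq.
apply: contrapT => npa; have : basic (~` a) p by rewrite basicC.
by move=> /pq; rewrite basicC; apply.
Qed.

Lemma stone_hausdorff : hausdorff_space stone.
Proof.
rewrite open_hausdorff => p q pq.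
have [a [pa nqa]] : exists a, basic a p /\ ~ basic a q.
  apply: contrapT => npq; move/eqP: pq; apply; apply: stone_ext => a pa.
  by apply: contrapT => nqa; apply: npq; exists a.
exists (basic a, basic (~` a)); rewrite /= ?inE; first by rewrite basicC.
by split; [exact: basic_open|exact: basic_open|rewrite basicC setICr].
Qed.

(** Zorn's lemma gives a maximal proper filter containing [a], and maximality makes it an
    ultrafilter. *)
Lemma ultrafilter_exists a : a != \bot -> exists p : stone, basic a p.
Proof.
move=> a0.
pose proper (F : set A) := [/\ F a, ~ F \bot,
  forall x y, F x -> F y -> F (x `&` y) & forall x y, F x -> x <= y -> F y].
(* The empty set is allowed as an upper bound of the empty chain. *)
pose P (F : set A) := F = set0 \/ proper F.
have [F [PF Fmax]] : exists F, P F /\ forall G, (F `<` G)%classic -> ~ P G.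
  apply: Zorn_bigcup => C CP Ctot.
  have [[F CF Fa]|noF] := pselect (exists2 F, C F & F a); last first.
    left; apply/seteqP; split=> // x [F CF Fx].
    have [F0|[Fa _ _ _]] := CP _ CF; first by rewrite F0 in Fx.
    by apply: noF; exists F.
  have CP' G x : C G -> G x -> proper G.
    by move=> CG Gx; have [G0|//] := CP _ CG; rewrite G0 in Gx.
  right; split.
  - by exists F.
  - by move=> [G CG G0]; have [_ + _ _] := CP' _ _ CG G0; apply.
  - move=> x y [G CG Gx] [H CH Hy].
    have [GH|HG] := Ctot _ _ CG CH.
      by exists H => //; have [_ _ + _] := CP' _ _ CH Hy; apply=> //; exact: GH.
    by exists G => //; have [_ _ + _] := CP' _ _ CG Gx; apply=> //; exact: HG.
  - move=> x y [G CG Gx] xy; exists G => //.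
    by have [_ _ _] := CP' _ _ CG Gx; apply; eassumption.
have Fproper : proper F.
  (* The principal filter at [a] strictly contains the empty set. *)
  case: PF => // F0; exfalso; apply: (Fmax [set x | a <= x]).
    split=> [|/(_ a (lexx a))]; rewrite F0 //; exact: sub0set.
  right; split=> /= [||x y|x y]; first exact: lexx.
  - by rewrite lex0; exact/negP.
  - by rewrite lexI => -> ->.
  - exact: le_trans.
have [Fa F0 FI FS] := Fproper.
(* Otherwise [F] and [x] together generate a strictly larger proper filter. *)
have Fdisj x : ~ F x -> exists2 y, F y & y `&` x = \bot.
  move=> nFx; apply: contrapT => nex.
  apply: (Fmax [set z | exists2 y, F y & y `&` x <= z]).
    split=> [y Fy|/(_ x)]; first by exists y => //; exact: leIl.
    by move=> Fsub; apply: nFx; apply: Fsub; exists a => //; exact: leIr.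
  right; split=> /=.
  - by exists a => //; exact: leIl.
  - by move=> [y Fy]; rewrite lex0 => /eqP yx; apply: nex; exists y.
  - move=> z t [y Fy yz] [y' Fy' yt]; exists (y `&` y'); first exact: FI.
    rewrite lexI; apply/andP; split.
      by apply: le_trans yz; rewrite leI2 ?leIl.
    by apply: le_trans yt; rewrite leI2 ?leIr.
  - by move=> z t [y Fy yz] zt; exists y => //; exact: le_trans zt.
have up : ultrafilter_of F.
  split=> [|x y|x].
  - by apply: FS Fa _; exact: lex1.
  - split=> [Fxy|[]]; last exact: FI.
    by split; apply: FS Fxy _; [exact: leIl|exact: leIr].
  - split=> [FC Fx|/Fdisj[y Fy yx]]; first by
      apply: F0; rewrite -(meetxC x); exact: FI.
    by apply: FS Fy _; rewrite -disj_leC; apply/eqP.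
by exists (exist _ F up).
Qed.

Lemma basic_le a b : (basic a `<=` basic b)%classic -> a <= b.
Proof.
move=> ab; rewrite -[b]complK -disj_leC; apply/eqP; apply: contrapT => /eqP.
move=> /ultrafilter_exists [p]; rewrite basicI basicC => -[/ab ? ?]; contradiction.
Qed.

Lemma basic_inj : injective basic.
Proof.
by move=> a b ab; apply/eqP; rewrite eq_le !basic_le ?ab.
Qed.

Lemma stone_clopen (C : set stone) : clopen C -> exists a, basic a = C.
Proof.
move=> [oC cC].
have [a Ca aC] : exists2 a, (C `&` setT `<=` basic a)%classic & (basic a `<=` C)%classic.
  (* [P U] says that a single basic set inside [C] covers the part of [C] in [U]; off [C] the
     neighbourhood is the complement of [C], with the bottom element as witness. *)
  pose P U := exists2 a, (C `&` U `<=` basic a)%classic & (basic a `<=` C)%classic.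
  apply: (@compact_induction _ P stone_compact).
  - by exists \bot; rewrite ?setI0 ?basic0.
  - move=> U V [a Ua aC] [b Vb bC]; exists (a `|` b); rewrite basicU.
      by rewrite setIUr; exact: setUSS.
    by rewrite subUset.
  - move=> U V UV [a Va aC]; exists a => //.
    by apply: subset_trans Va; exact: setIS.
  - move=> p; have [Cp|nCp] := pselect (C p).
      have [a pa aC] := oC _ Cp; exists (basic a).
        by apply: open_nbhs_nbhs; split=> //; exact: basic_open.
      by exists a => //; exact: subIsetr.
    exists (~` C)%classic.
      by apply: open_nbhs_nbhs; split=> //; exact: closed_openC.
    by exists \bot; rewrite ?basic0 ?setICr.
by exists a; apply/seteqP; split=> // p Cp; apply: Ca.
Qed.

Lemma stone_extremally_disconnected :
  is_complete A -> extremally_disconnected stone.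
Proof.
move=> cA U oU.
(* The closure of [U] is the basic set of the supremum of all [a] whose basic set lies in [U]. *)
have [[s [sU sl]] _] := cA [set a | (basic a `<=` U)%classic].
suff -> : closure U = basic s by exact: basic_open.
apply/seteqP; split.
  rewrite [X in (_ `<=` X)%classic](closure_id _).1; last exact: basic_closed.
  apply: closure_subset => p /oU[a pa /sU as_].
  have : basic (a `&` s) p by move/meet_l: as_ => ->.
  by rewrite basicI => -[].
move=> p ps V; rewrite nbhsE => -[O [oO Op] OV].
have [c pc cO] := oO _ Op.
apply: contrapT => nUV.
(* A basic neighbourhood [basic c] of [p] missing [U] makes the complement of [c] an upper bound, so
   [s] lies below it, although [p] contains both [s] and [c]. *)
have /sl sc : ubound [set a | (basic a `<=` U)%classic] (~` c).
  move=> a aU; apply: basic_le => q qa; rewrite basicC => qc.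
  by apply: nUV; exists q; split; [exact: aU|exact/OV/cO].
have : basic (s `&` ~` c) p by move/meet_l: sc => ->.
by rewrite basicI basicC => -[].
Qed.
End StoneSpace.

(** * The Stone space functor *)

Section StoneFunctor.
Local Open Scope order_scope.

Section Map.
Variables (A B : boolAlg) (f : A -> B).
Hypothesis fhom : is_bool_hom f.

Fact stone_map_subproof (p : stone B) : ultrafilter_of (sval p \o f).
Proof.
have [fI _ fC _ f1] := fhom; have [p1 pI pC] := svalP p.
by split=> [|x y|x]; rewrite /= ?f1 ?fI ?fC.
Qed.

Definition stone_map (p : stone B) : stone A :=
  exist _ _ (stone_map_subproof p).

Lemma preimage_stone_map a : stone_map @^-1` basic a = basic (f a).
Proof. by []. Qed.

Lemma stone_map_continuous : continuous stone_map.
Proof.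
apply/continuousP => O oO; rewrite stone_openE => p Op.
by have [a pa aO] := oO _ Op; exists (f a) => // q; exact: (aO (stone_map q)).
Qed.
End Map.

Definition stone_fobj (A : opposite cBA) : ED :=
  exist _ (stone (sval A) : topologicalType)
    (And3 (@stone_compact (sval A)) (@stone_hausdorff (sval A))
      (stone_extremally_disconnected (svalP A))).

Definition stone_fhom (A B : opposite cBA) (f : hom A B) :
    hom (stone_fobj A) (stone_fobj B) :=
  exist _ (stone_map (svalP f)) (@stone_map_continuous _ _ _ (svalP f)).

Fact stone_fhom1 (A : opposite cBA) : stone_fhom (idm A) = idm (stone_fobj A).
Proof. by apply: sval_inj; apply/funext => p; exact: sval_inj. Qed.

Fact stone_fhomM (A B C : opposite cBA) (g : hom B C) (f : hom A B) :
  stone_fhom (comp g f) = comp (stone_fhom g) (stone_fhom f).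
Proof. by apply: sval_inj; apply/funext => p; exact: sval_inj. Qed.

Definition stone_functor : functor (opposite cBA) ED :=
  Functor stone_fhom1 stone_fhomM.

Lemma stone_functor_fully_faithful : fully_faithful stone_functor.
Proof.
move=> A B; split=> [f g /(congr1 sval) fg|[h hc]].
  apply: sval_inj; apply/funext => b; apply: basic_inj.
  have /= fgE : stone_map (svalP f) = stone_map (svalP g) := fg.
  by rewrite -(preimage_stone_map (svalP f)) -(preimage_stone_map (svalP g)) fgE.
have hclopen (b : sval B) : clopen (h @^-1` basic b).
  split; first by move/continuousP: hc; apply; exact: basic_open.
  by move/continuous_closedP: hc; apply; exact: basic_closed.
(* [f b] is the element whose basic set is the clopen preimage; injectivity of [basic] makes [f] a
   homomorphism. *)
have [f fP] := choice (fun b => stone_clopen (hclopen b)).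
have fhom : @is_bool_hom (sval B) (sval A) f.
  by split=> [x y|x y|x||]; apply: basic_inj;
    rewrite ?(basicI, basicU, basicC, basicT, basic0, fP).
exists (exist _ f fhom); apply: sval_inj; apply/funext => p.
apply: stone_ext => b /=.
by rewrite -[basic b _]/((h @^-1` basic b) p) -fP.
Qed.
End StoneFunctor.

(** * Locally constant functions *)

Section LocallyConstant.
Variables (R : comPzRingType) (X : topologicalType).

(** A boolean predicate, so that the ring structure is inherited from [X -> R] as a subring. *)
Definition locally_constant : {pred X -> R} :=
  fun f => `[< forall x, \forall y \near x, f y = f x >].

Lemma locally_constantP (f : X -> R) :
  reflect (forall x, \forall y \near x, f y = f x) (f \in locally_constant).
Proof. exact: asboolP. Qed.

Fact locally_constant_subring : subring_closed locally_constant.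
Proof.
split=> [|f g|f g].
- by apply/locally_constantP => x; exact: nearW.
- move=> /locally_constantP fP /locally_constantP gP; apply/locally_constantP => x.
  by apply: filterS2 (fP x) (gP x) => y; rewrite !fctE => -> ->.
- move=> /locally_constantP fP /locally_constantP gP; apply/locally_constantP => x.
  by apply: filterS2 (fP x) (gP x) => y; rewrite !fctE => -> ->.
Qed.

Definition lcfun := {f : X -> R | f \in locally_constant}.
HB.instance Definition _ := SubChoice.on lcfun.
HB.instance Definition _ :=
  GRing.SubChoice_isSubComPzRing.Build (X -> R) locally_constant lcfun
    locally_constant_subring.

Implicit Types (f g : lcfun) (x : X).

Lemma lcB f g x : val (f - g) x = val f x - val g x. Proof. by []. Qed.
Lemma lcM f g x : val (f * g) x = val f x * val g x. Proof. by []. Qed.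
Lemma lc0 x : val (0 : lcfun) x = 0. Proof. by []. Qed.

Lemma lc_ext f g : (forall x, val f x = val g x) -> f = g.
Proof. by move=> fg; apply/val_inj/funext. Qed.

Lemma lc_near f x : \forall y \near x, val f y = val f x.
Proof. exact: (locally_constantP _ (valP f)). Qed.

(** [V] is arbitrary: a locally constant function is continuous for the discrete topology on [R]. *)
Lemma lc_preimage_open f (V : set R) : open ((val f : X -> R) @^-1` V).
Proof.
by rewrite openE => x Vfx; near=> y; rewrite /= (near (lc_near f x) y).
Unshelve. all: by end_near. Qed.

Lemma lc_preimage_clopen f (V : set R) : clopen ((val f : X -> R) @^-1` V).
Proof.
split; first exact: lc_preimage_open.
by rewrite -[V]setCK preimage_setC; exact: open_closedC (lc_preimage_open f (~` V)).
Qed.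

Fact lc_const_subproof (r : R) : cst r \in locally_constant.
Proof. by apply/locally_constantP => x; exact: nearW. Qed.
Definition lc_const (r : R) : lcfun := exist _ (cst r) (lc_const_subproof r).

Fact lc_const_additive : zmod_morphism lc_const.
Proof. by move=> r s; exact: lc_ext. Qed.
Fact lc_const_multiplicative : monoid_morphism lc_const.
Proof. by split=> [|r s]; exact: lc_ext. Qed.
HB.instance Definition _ :=
  GRing.isZmodMorphism.Build R lcfun lc_const lc_const_additive.
HB.instance Definition _ :=
  GRing.isMonoidMorphism.Build R lcfun lc_const lc_const_multiplicative.

Definition lcAlg : comAlg R := @ComAlg R lcfun lc_const.

Lemma alg_mapE r x : val (alg_map lcAlg r : lcfun) x = r. Proof. by []. Qed.

Definition lc_indic_fun (U : set X) : X -> R := fun x => `[< U x >]%:R.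

Fact lc_indic_subproof (U : set X) :
  clopen U -> lc_indic_fun U \in locally_constant.
Proof.
move=> [oU cU]; apply/locally_constantP => x; rewrite /lc_indic_fun.
have [Ux|nUx] := pselect (U x).
  have := open_nbhs_nbhs (conj oU Ux); apply: filterS => y Uy.
  by rewrite !asboolT.
have := open_nbhs_nbhs (conj (closed_openC cU) nUx); apply: filterS => y nUy.
by rewrite !asboolF.
Qed.

Definition lc_indic (U : set X) (cU : clopen U) : lcfun :=
  exist _ (lc_indic_fun U) (lc_indic_subproof cU).

Lemma lc_indic1 (U : set X) (cU : clopen U) x : U x -> val (lc_indic cU) x = 1.
Proof. by move=> Ux; rewrite /= /lc_indic_fun asboolT. Qed.

Lemma lc_indic0 (U : set X) (cU : clopen U) x : ~ U x -> val (lc_indic cU) x = 0.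
Proof. by move=> Ux; rewrite /= /lc_indic_fun asboolF. Qed.

Lemma lc_indicM (U : set X) (cU : clopen U) :
  lc_indic cU * lc_indic cU = lc_indic cU.
Proof.
by apply: lc_ext => x; rewrite lcM /= /lc_indic_fun; case: asbool;
  rewrite ?mulr1 ?mulr0.
Qed.
End LocallyConstant.

(** * Locally constant functions with values in a domain *)

Section Domain.
Variables (R : idomainType) (X : topologicalType).
Local Notation S := (lcAlg R X).
Implicit Types (e f : idem S) (x : X).

Lemma idem_lc01 e x : val (val e) x = 0 \/ val (val e) x = 1.
Proof.
have /(congr1 val)/(congr1 (@^~ x)) := idemE e.
rewrite lcM -[in RHS](mulr1 (val (val e) x)) => /eqP.
rewrite -subr_eq0 -mulrBr mulf_eq0 subr_eq0 => /orP[] /eqP; by [left|right].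
Qed.

Definition lc_support e : set X := [set x | val (val e) x = 1].

Lemma lc_supportE e x : lc_support e x = (val (val e) x = 1).
Proof. by []. Qed.

Lemma lc_supportN e x : ~ lc_support e x -> val (val e) x = 0.
Proof. by have [] := idem_lc01 e x. Qed.

Lemma lc_support_inj : injective lc_support.
Proof.
move=> e f ef; apply/val_inj/lc_ext => x.
have [ex|nex] := pselect (lc_support e x).
  by move: (ex); rewrite ef ex => ->.
by rewrite lc_supportN // lc_supportN // -ef.
Qed.

Lemma lc_meetE e f x :
  val (val (e `&` f)%O) x = val (val e) x * val (val f) x.
Proof. exact: (lcM (val e) (val f) x). Qed.

Lemma lc_complE e x : val (val (~` e)%O) x = 1 - val (val e) x.
Proof. exact: (lcB 1 (val e) x). Qed.

Lemma lc_supportT : lc_support \top%O = setT.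
Proof. by apply/seteqP. Qed.

Lemma lc_supportI e f :
  lc_support (e `&` f)%O = lc_support e `&` lc_support f.
Proof.
apply/seteqP; split=> x; last first.
  by move=> [ex fx]; rewrite lc_supportE lc_meetE ex fx mulr1.
rewrite lc_supportE lc_meetE; have [e0|e1] := idem_lc01 e x.
  by rewrite e0 mul0r => /esym/eqP; rewrite oner_eq0.
by rewrite e1 mul1r.
Qed.

Lemma lc_supportC e : lc_support (~` e)%O = ~` lc_support e.
Proof.
apply/seteqP; split=> x; rewrite lc_supportE lc_complE.
  by move=> + ex; rewrite ex subrr => /esym/eqP; rewrite oner_eq0.
by move=> /lc_supportN ->; rewrite subr0.
Qed.

Lemma lc_supportU e f :
  lc_support (e `|` f)%O = lc_support e `|` lc_support f.
Proof.
rewrite -[(e `|` f)%O]complK complU lc_supportC lc_supportI !lc_supportC.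
by rewrite setCI !setCK.
Qed.

Lemma lc_support0 : lc_support \bot%O = set0.
Proof. by rewrite -compl1 lc_supportC lc_supportT setCT. Qed.

Lemma lc_support_clopen e : clopen (lc_support e).
Proof. exact: (@lc_preimage_clopen _ _ (val e) [set 1]). Qed.

Lemma clopen_lc_support (U : set X) : clopen U -> exists e, lc_support e = U.
Proof.
move=> cU; exists (idem_of (lc_indicM R cU)).
apply/seteqP; split=> x; rewrite lc_supportE; last exact: lc_indic1.
apply: contraPP => nUx; rewrite lc_indic0 //.
by move=> /esym/eqP; rewrite oner_eq0.
Qed.

Lemma idempotents_boolean_subalgebra (T : comAlg R) :
  boolean_subalgebra (@idempotents R T).
Proof.
split=> //=; rewrite /idempotents /= ?mulr0 ?mulr1 //.
by split=> [e f ee ff|e f ee ff|e ee]; [ring: ee ff|ring: ee ff|ring: ee].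
Qed.

Lemma lc_generates : compact [set: X] -> generates (@idempotents R S).
Proof.
move=> cX; apply/seteqP; split=> // f _ A [[A1 AD AM AZ] idemA].
(* Compact induction reaches [P setT], where [e] must be 1 and hence [f] itself lies in the
   subalgebra [A]. *)
pose P U := exists e, U `<=` lc_support e /\ A (f * val e).
have [e [eT Afe]] : P setT.
  apply: (compact_induction cX).
  - exists \bot%O; split=> //=; rewrite mulr0; apply: idemA; exact: mulr0.
  - move=> U V [e [Ue Ae]] [e' [Ve' Ae']]; exists (e `|` e')%O; split.
      by rewrite lc_supportU; exact: setUSS.
    (* Inclusion-exclusion, with subtraction expressed through the scalar -1. *)
    have -> : f * val (e `|` e')%O = f * val e + f * val e' +
                alg_map S (-1) * (f * val e * val e').
      by rewrite rmorphN rmorph1 /=; ring.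
    apply: (AD); first exact: AD.
    by apply: AZ; apply: AM => //; apply: idemA; exact: idemE.
  - by move=> U V UV [e [Ve Ae]]; exists e; split=> //; exact: subset_trans UV Ve.
  - move=> x; exists (val f @^-1` [set val f x]); first exact: lc_near.
    have [e eE] := clopen_lc_support (lc_preimage_clopen f [set val f x]).
    exists e; split; first by rewrite eE.
    (* The support of [e] is the level set of [f] through [x], so [f] is scalar on it. *)
    have -> : f * val e = alg_map S (val f x) * val e.
      apply: lc_ext => y; rewrite !lcM alg_mapE.
      have [|/lc_supportN ->] := pselect (lc_support e y); last by rewrite !mulr0.
      by rewrite eE /= => ->.
    by apply: AZ; apply: idemA; exact: idemE.
have e1 : e = \top%O.
  by apply: lc_support_inj; rewrite lc_supportT; apply/seteqP; split.
by rewrite e1 mulr1 in Afe.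
Qed.

Lemma lc_specker : compact [set: X] -> is_specker S.
Proof.
move=> cX; exists (@idempotents R S); split.
- exact: idempotents_boolean_subalgebra.
- exact: lc_generates.
move=> e ee e0 a ae.
(* Faithfulness is tested at a point where [e] does not vanish, [R] being a domain. *)
have [x ex] : exists x, val e x != 0.
  apply: contrapT => /forallNP noe; move/eqP: e0; apply; apply: lc_ext => x.
  by have /negP/negPn/eqP := noe x.
have /eqP : val (alg_map S a * e) x = 0 by rewrite ae.
by rewrite lcM alg_mapE mulf_eq0 (negbTE ex) orbF => /eqP.
Qed.

(** The annihilator of [Y] consists of the functions vanishing on the open set [U] where some member
    of [Y] is nonzero. By local constancy they vanish on its closure, which is clopen, so the
    indicator of the complement generates the annihilator. *)
Lemma lc_baer : extremally_disconnected X -> is_baer S.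
Proof.
move=> edX Y.
pose U := \bigcup_(g in Y) (val g @^-1` [set~ 0]).
have oU : open U by apply: bigcup_open => g _; exact: lc_preimage_open.
have cU : clopen (~` closure U).
  by split; [exact/closed_openC/closed_closure|exact/open_closedC/edX].
exists (lc_indic R cU); split; first exact: lc_indicM.
apply/seteqP; split=> [f fY|_ [s _ <-] g Yg].
  exists f => //; apply: lc_ext => x; rewrite lcM.
  have [nUx|/contrapT Ux] := pselect ((~` closure U) x).
    by rewrite lc_indic1 // mulr1.
  rewrite lc_indic0 ?mulr0; last by apply.
  have [y [[g Yg gy] <-]] := Ux _ (lc_near f x).
  have /(congr1 val)/(congr1 (@^~ y)) := fY g Yg.
  by move=> /eqP; rewrite lcM lc0 mulf_eq0 => /orP[/eqP //|/eqP /gy].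
apply: lc_ext => x; rewrite !lcM lc0.
have [nUx|/contrapT Ux] := pselect ((~` closure U) x); last first.
  by rewrite lc_indic0 ?mulr0 ?mul0r //; apply.
have [->|/eqP gx] := eqVneq (val g x) 0; first by rewrite mulr0.
by exfalso; apply/nUx/subset_closure; exists g.
Qed.
End Domain.

(** * Essential surjectivity *)

Definition lcBSp (R : idomainType) (X : topologicalType)
    (cX : compact [set: X]) (edX : extremally_disconnected X) : BSp R :=
  exist _ (exist (fun S : CAlg R => is_specker S) (lcAlg R X) (@lc_specker R X cX))
    (@lc_baer R X edX).

(** Idempotents of the function algebra on the Stone space correspond by [lc_support] to clopens,
    and these by [basic] to elements of [A]; [u] and [v] are the two directions. *)
Lemma idem_functor_essentially_surjective (R : idomainType) :
  essentially_surjective (idem_functor R).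
Proof.
move=> A; pose X := stone (sval A).
have [u uP] := choice (fun e : idem (lcAlg R X) => stone_clopen (lc_support_clopen e)).
have [v vP] := choice (fun a : sval A =>
  clopen_lc_support R (conj (@basic_open _ a) (@basic_closed _ a))).
have uhom : @is_bool_hom (idemBA (lcAlg R X)) (sval A) u.
  split=> [e f|e f|e||]; apply: basic_inj; rewrite uP.
  - by rewrite basicI !uP lc_supportI.
  - by rewrite basicU !uP lc_supportU.
  - by rewrite basicC uP lc_supportC.
  - by rewrite basic0 lc_support0.
  - by rewrite basicT lc_supportT.
have vhom : @is_bool_hom (sval A) (idemBA (lcAlg R X)) v.
  split=> [a b|a b|a||]; apply: lc_support_inj; rewrite vP.
  - by rewrite basicI lc_supportI !vP.
  - by rewrite basicU lc_supportU !vP.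
  - by rewrite basicC lc_supportC vP.
  - by rewrite basic0 lc_support0.
  - by rewrite basicT lc_supportT.
exists (lcBSp R (@stone_compact _) (stone_extremally_disconnected (svalP A))).
exists (exist _ u uhom), (exist _ v vhom).
split; apply: sval_inj; apply/funext => e /=.
  by apply: lc_support_inj; rewrite vP uP.
by apply: basic_inj; rewrite uP vP.
Qed.

(** For disjoint open neighbourhoods [U] of [x] and [V] of [y], the closure of [U] is clopen and
    still misses [V]. *)
Lemma clopen_separation (X : topologicalType) (x y : X) :
  hausdorff_space X -> extremally_disconnected X -> x != y ->
  exists U : set X, [/\ clopen U, U x & ~ U y].
Proof.
rewrite open_hausdorff => hX edX /hX [[U V] /= []].
rewrite !inE => Ux Vy [oU oV UV0].
exists (closure U); split=> [|//|/(_ V)].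
- by split; [exact: edX|exact: closed_closure].
- exact: subset_closure.
move=> /(_ (open_nbhs_nbhs (conj oV Vy))) [z UVz].
by rewrite UV0 in UVz.
Qed.

Lemma stone_idem_essentially_surjective (R : idomainType) :
  essentially_surjective
    (functor_comp stone_functor (opposite_functor (idem_functor R))).
Proof.
move=> [X [cX hX edX]].
pose A := idemBA (lcAlg R X).
pose P := stone A.
have up (x : X) : ultrafilter_of (A := A) [set e | lc_support e x].
  split=> [|e f|e] /=; first by rewrite lc_supportT.
  - by rewrite lc_supportI; split.
  - by rewrite lc_supportC; split.
(* A point goes to the ultrafilter of the idempotents with value 1 there. *)
pose w (x : X) : P := exist _ _ (up x).
have basic_w (e : A) : w @^-1` basic e = lc_support e by [].
have w_continuous : continuous w.
  apply/continuousP => O oO; rewrite openE => x Ox.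
  have [e ex eO] := oO _ Ox; apply: (@filterS _ _ _ (lc_support e)).
    by rewrite -basic_w => y; exact: eO.
  by apply: open_nbhs_nbhs; split=> //; have [] := lc_support_clopen e.
have w_inj : injective w.
  move=> x y wxy; apply/eqP/negPn/negP => /(clopen_separation hX edX)[U [cU Ux nUy]].
  have [e eU] : exists e : A, _ := clopen_lc_support R cU; apply: nUy.
  have : basic e (w x) by rewrite -[basic e _]/(lc_support e x) eU.
  by rewrite wxy -[basic e _]/(lc_support e y) eU.
have w_surj (p : P) : exists x, w x = p.
  (* The supports of the members of [p] generate a proper filter. Supports are closed, so a cluster
     point [x] lies in all of them and [w x = p]. *)
  pose F := [set U : set X | exists2 e : A, basic e p & lc_support e `<=` U].
  have FF : ProperFilter F.
    split.
      move=> [e ep e0]; have e_bot : e = \bot%O.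
        by apply: lc_support_inj; rewrite lc_support0 -subset0.
      by move: ep; rewrite e_bot basic0.
    split.
    - by exists \top%O; rewrite ?basicT.
    - move=> U V [e ep eU] [f fp fV]; exists (e `&` f)%O; first by rewrite basicI.
      by rewrite lc_supportI; exact: setISS.
    - by move=> U V UV [e ep eU]; exists e => //; exact: subset_trans UV.
  have [|x [_ Fx]] := cX F FF; first by exists \top%O; rewrite ?basicT.
  exists x; apply/esym/stone_ext => e ep; rewrite -[basic e _]/(lc_support e x).
  have [_ +] := lc_support_clopen e; apply=> U /Fx; apply; by exists e.
have [u uP] := choice w_surj.
have u_continuous : continuous u.
  apply/continuous_closedP => C cC.
  (* A continuous bijection from a compact space to a Hausdorff space is closed, so its inverse [u]
     is continuous. *)
  have -> : u @^-1` C = w @` C.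
    apply/seteqP; split=> [p Cp|_ [x Cx <-]]; first by exists (u p).
    by rewrite /= (w_inj (u (w x)) x).
  apply: compact_closed; first exact: stone_hausdorff.
  apply: continuous_compact; first exact: continuous_subspaceT.
  exact: subclosed_compact cC cX _.
exists (lcBSp R cX edX), (exist _ u u_continuous), (exist _ w w_continuous).
split; apply: sval_inj; apply/funext => p /=; first exact: uP.
by apply: w_inj; rewrite uP.
Qed.

Theorem theorem4p7 (R : idomainType) :
  equivalent_categories (BSp R) cBA /\
  dually_equivalent_categories (BSp R) ED.
Proof.
have idem_ff := @idem_functor_full_faithful R.
split; first exact: equivalence_of_fully_faithful idem_ff
  (@idem_functor_essentially_surjective R).
(* The duality is the Stone functor composed with the opposite of the idempotent functor. *)
apply: equivalence_of_fully_faithful (@stone_idem_essentially_surjective R).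
apply: fully_faithful_comp; first exact: stone_functor_fully_faithful.
exact: fully_faithful_opposite.
Qed.
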